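(* Let $\Gamma$ be a quiver. For each $n\geq0$, there is a natural transformation $\rho_n$ from the functor $H_n\circ\lim^{\Gamma,\bullet}:\mathbf{C}\text{-}\mathbf{Rep}\,\Gamma\to\mathbf{Ab}$ to the functor $\lim^{\Gamma}\circ H_n^{\Gamma}:\mathbf{C}\text{-}\mathbf{Rep}\,\Gamma\to\mathbf{Ab}$.
   Context: A quiver $\Gamma=(\Gamma_0,\Gamma_1)$ is an oriented graph with vertex set $\Gamma_0$ and arrow set $\Gamma_1$. $\mathbf{Ab}$ is the category of abelian groups and $\mathbf C$ the category of chain complexes of abelian groups with chain maps. $\mathbf{Ab}\text{-}\mathbf{Rep}\,\Gamma$ (resp. $\mathbf{C}\text{-}\mathbf{Rep}\,\Gamma$) is the category whose objects consist of an object $G(i)$ of $\mathbf{Ab}$ (resp. of $\mathbf{C}$) for each vertex $i$ and a morphism $f_\alpha:G(i)\to G(j)$ for each arrow $\alpha:i\to j$; morphisms are families of morphisms at the vertices commuting with the structure maps. For $(G,f)\in\mathbf{Ab}\text{-}\mathbf{Rep}\,\Gamma$, the $\Gamma$-limit is the subgroup $$\textstyle\lim^{\Gamma}(G,f)=\{(x_i)_{i\in\Gamma_0}: x_i\in G(i),\ f_\alpha(x_i)=x_j\text{ for every arrow }\alpha:i\to j\}\subseteq\prod_{i\in\Gamma_0}G(i).$$ For $(C,f)\in\mathbf{C}\text{-}\mathbf{Rep}\,\Gamma$, $\lim^{\Gamma,\bullet}(C,f)$ is the subcomplex of $\prod_{i\in\Gamma_0}C(i)$ whose degree $n$ part is $\lim^\Gamma(C^n,f^n)$,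 where $C^n(i)=C(i)_n$ and $(f^n)_\alpha=(f_\alpha)_n$. Both constructions act on morphisms componentwise. $H_n^\Gamma:\mathbf{C}\text{-}\mathbf{Rep}\,\Gamma\to\mathbf{Ab}\text{-}\mathbf{Rep}\,\Gamma$ is the functor applying the homology functor $H_n$ at each vertex, arrow and component of a morphism. *)

(* Defs.v *)
From HB Require Import structures.
From mathcomp Require Import all_boot all_algebra.
From mathcomp Require Import boolp.

Set Implicit Arguments.
Unset Strict Implicit.
Unset Printing Implicit Defensive.

Import GRing.Theory.
Local Open Scope ring_scope.

(* Hom-sets carry Leibniz equality: the axioms of boolp (functional and
   propositional extensionality) identify morphisms with equal values. *)
Record category := Category {
  ob :> Type;
  hom : ob -> ob -> Type;
  idm : forall A, hom A A;
  compm : forall A B C, hom B C -> hom A B -> hom A C;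
  compm1 : forall A B (f : hom A B), compm f (idm A) = f;
  comp1m : forall A B (f : hom A B), compm (idm B) f = f;
  compmA : forall A B C D (h : hom C D) (g : hom B C) (f : hom A B),
    compm h (compm g f) = compm (compm h g) f }.
Arguments idm {c} A.
Arguments compm {c A B C} g f : rename.

Record functor (C D : category) := Functor {
  fob :> C -> D;
  fmap : forall A B : C, hom A B -> hom (fob A) (fob B);
  fmap1 : forall A : C, fmap (idm A) = idm (fob A);
  fmapM : forall (A B E : C) (g : hom B E) (f : hom A B),
    fmap (compm g f) = compm (fmap g) (fmap f) }.
Arguments fmap {C D} F {A B} f : rename.

Section FunctorComp.
Variables (C D E : category) (G : functor D E) (F : functor C D).

Fact fcomp_map1 (A : C) : fmap G (fmap F (idm A)) = idm (G (F A)).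
Proof. by rewrite !fmap1. Qed.

Fact fcomp_mapM (A B K : C) (g : hom B K) (f : hom A B) :
  fmap G (fmap F (compm g f)) = compm (fmap G (fmap F g)) (fmap G (fmap F f)).
Proof. by rewrite !fmapM. Qed.

Definition fcomp : functor C E := Functor fcomp_map1 fcomp_mapM.
End FunctorComp.

Record natTrans (C D : category) (F G : functor C D) := NatTrans {
  ntc :> forall A : C, hom (F A) (G A);
  nt_natural : forall (A B : C) (f : hom A B),
    compm (ntc B) (fmap F f) = compm (fmap G f) (ntc A) }.

Lemma additive_ext (U V : zmodType) (f g : {additive U -> V}) :
  f =1 g -> f = g.
Proof.
case: f g => [f [[f0]]] [g [[g0]]] /= /funext fg; subst g.
by rewrite (Prop_irrelevance f0 g0).
Qed.

Definition Ab : category.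
Proof.
refine (@Category zmodType (fun U V => {additive U -> V})
  (fun U => idfun) (fun U V W g f => g \o f) _ _ _).
- by move=> U V f; apply: additive_ext.
- by move=> U V f; apply: additive_ext.
- by move=> U V W X h g f; apply: additive_ext.
Defined.

Definition kerp (U V : zmodType) (f : {additive U -> V}) : pred U :=
  fun x => f x == 0.

Section Ker.
Variables (U V : zmodType) (f : {additive U -> V}).

Fact kerp_closed : zmod_closed (kerp f).
Proof.
split=> [|x y]; rewrite /in_mem /= /kerp ?raddf0 // raddfB.
by move=> /eqP-> /eqP->; rewrite subr0.
Qed.
HB.instance Definition _ := GRing.isZmodClosed.Build U (kerp f) kerp_closed.

Record ker := Ker { ker_val : U; ker_valP : ker_val \in kerp f }.
HB.instance Definition _ := [isSub for ker_val].
HB.instance Definition _ := [Choice of ker by <:].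
HB.instance Definition _ := [SubChoice_isSubZmodule of ker by <:].

Lemma ker_valB : {morph ker_val : x y / x - y}.
Proof. by move=> x y; exact: (raddfB (val : ker -> U)). Qed.
Lemma ker_val0 : ker_val 0 = 0.
Proof. exact: (raddf0 (val : ker -> U)). Qed.
Lemma ker_val_inj : injective ker_val. Proof. exact: val_inj. Qed.
End Ker.

Definition dprod (I : Type) (G : I -> zmodType) := forall i, G i.

Section Product.
Variables (I : Type) (G : I -> zmodType).
Implicit Types x y z : dprod G.

Let add x y : dprod G := fun i => x i + y i.
Let opp x : dprod G := fun i => - x i.
Let zero : dprod G := fun i => 0.

Fact dprod_addA : associative add.
Proof. by move=> x y z; apply: functional_extensionality_dep => i; exact: addrA. Qed.
Fact dprod_addC : commutative add.
Proof. by move=> x y; apply: functional_extensionality_dep => i; exact: addrC. Qed.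
Fact dprod_add0 : left_id zero add.
Proof. by move=> x; apply: functional_extensionality_dep => i; exact: add0r. Qed.
Fact dprod_addN : left_inverse zero opp add.
Proof. by move=> x; apply: functional_extensionality_dep => i; exact: addNr. Qed.

HB.instance Definition _ := Choice.copy (dprod G) (forall i, G i).
HB.instance Definition _ := GRing.isZmodule.Build (dprod G)
  dprod_addA dprod_addC dprod_add0 dprod_addN.

Lemma dprodB x y i : (x - y) i = x i - y i. Proof. by []. Qed.
Lemma dprod0 i : (0 : dprod G) i = 0. Proof. by []. Qed.
End Product.

(* The differential is a family [d i j : C i -> C j] vanishing unless
   [i = j + 1], which avoids transporting along [n - 1 + 1 = n]. *)
Record chainComplex := ChainComplex {
  cob :> int -> zmodType;
  cd : forall i j, {additive cob i -> cob j};
  cd_shape : forall i j, i != j + 1 -> forall x, cd i j x = 0;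
  cdd : forall i j k x, cd j k (cd i j x) = 0 }.
Arguments cd C i j : rename.

Record chainMap (C D : chainComplex) := ChainMap {
  cmap :> forall n, {additive C n -> D n};
  cmap_d : forall i j (x : C i), cmap j (cd C i j x) = cd D i j (cmap i x) }.

Lemma chainMap_ext (C D : chainComplex) (f g : chainMap C D) :
  (forall n, f n =1 g n) -> f = g.
Proof.
case: f g => [f f0] [g g0] /= fg.
have efg : f = g.
  by apply: functional_extensionality_dep => n; apply: additive_ext; exact: fg.
by subst g; rewrite (Prop_irrelevance f0 g0).
Qed.

Definition chainMap_id (C : chainComplex) : chainMap C C :=
  @ChainMap C C (fun n => idfun) (fun i j x => erefl).

Fact chainMap_comp_d (A B C : chainComplex) (g : chainMap B C)
    (f : chainMap A B) i j (x : A i) :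
  (g j \o f j) (cd A i j x) = cd C i j ((g i \o f i) x).
Proof. by rewrite /= !cmap_d. Qed.

Definition chainMap_comp (A B C : chainComplex) (g : chainMap B C)
  (f : chainMap A B) : chainMap A C :=
  @ChainMap A C (fun n => g n \o f n) (chainMap_comp_d g f).

Definition Ch : category.
Proof.
refine (@Category chainComplex chainMap chainMap_id chainMap_comp _ _ _).
- by move=> C D f; apply: chainMap_ext.
- by move=> C D f; apply: chainMap_ext.
- by move=> A B C D h g f; apply: chainMap_ext.
Defined.

Definition degF (n : int) : functor Ch Ab.
Proof.
refine (@Functor Ch Ab (fun C : chainComplex => C n : zmodType)
  (fun C D (f : chainMap C D) => f n) _ _) => //.
Defined.

Definition cycles (C : chainComplex) (n : int) : zmodType :=
  ker (cd C n (n - 1)).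

Definition bndp (C : chainComplex) (n : int) : pred (cycles C n) :=
  fun z => `[< exists y : C (n + 1), ker_val z = cd C (n + 1) n y >].

Fact bndp_closed C n : zmod_closed (@bndp C n).
Proof.
split=> [|x y].
  by apply/asboolP; exists 0; rewrite ker_val0 raddf0.
move=> /asboolP[u xu] /asboolP[v yv]; apply/asboolP; exists (u - v).
by rewrite ker_valB raddfB xu yv.
Qed.
HB.instance Definition _ C n :=
  GRing.isZmodClosed.Build (cycles C n) (@bndp C n) (bndp_closed C n).

Definition homology (C : chainComplex) (n : int) : zmodType :=
  Quotient.quot (GRing.ZmodClosed.clone (cycles C n) (@bndp C n) _).

Definition hclass (C : chainComplex) (n : int) (z : cycles C n) :
  homology C n := (\pi z)%qT.

Lemma hclass_surj C n (h : homology C n) : exists z, h = hclass z.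
Proof. by exists (repr h); rewrite /hclass reprK. Qed.

Lemma hclassB C n : {morph @hclass C n : x y / x - y}.
Proof. by move=> x y; exact: raddfB. Qed.

Lemma hclass_eq C n (x y : cycles C n) :
  hclass x = hclass y <->
  exists u : C (n + 1), ker_val x - ker_val y = cd C (n + 1) n u.
Proof.
rewrite /hclass; split=> [/eqP | H].
  by rewrite -Quotient.idealrBE => /asboolP; rewrite ker_valB.
by apply/eqP; rewrite -Quotient.idealrBE; apply/asboolP; rewrite ker_valB.
Qed.

Section HomologyMap.
Variables (C D : chainComplex) (f : chainMap C D) (n : int).

Fact cyclesMap_subproof (z : cycles C n) :
  f n (ker_val z) \in kerp (cd D n (n - 1)).
Proof.
by have /eqP dz := ker_valP z; apply/eqP; rewrite -cmap_d dz raddf0.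
Qed.

Definition cyclesMap (z : cycles C n) : cycles D n :=
  Ker (cyclesMap_subproof z).

Definition homologyMap (h : homology C n) : homology D n :=
  hclass (cyclesMap (repr h)).

Lemma homologyMapE (z : cycles C n) :
  homologyMap (hclass z) = hclass (cyclesMap z).
Proof.
have /hclass_eq[u eu] : hclass (repr (hclass z)) = hclass z.
  by rewrite /hclass reprK.
apply/hclass_eq; exists (f (n + 1) u).
by rewrite /= -raddfB -cmap_d -eu.
Qed.

Fact homologyMap_additive : zmod_morphism homologyMap.
Proof.
move=> a b; have [x ->] := hclass_surj a; have [y ->] := hclass_surj b.
rewrite -hclassB !homologyMapE -hclassB; congr hclass.
by apply/ker_val_inj; rewrite /= !(ker_valB, raddfB).
Qed.
HB.instance Definition _ := GRing.isZmodMorphism.Build _ _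
  homologyMap homologyMap_additive.
End HomologyMap.

Definition homologyF (n : int) : functor Ch Ab.
Proof.
refine (@Functor Ch Ab (fun C : chainComplex => homology C n)
  (fun C D f => @homologyMap C D f n : {additive _ -> _}) _ _).
- move=> C; apply: additive_ext => h; have [z ->] := hclass_surj h.
  by rewrite /= homologyMapE; congr hclass; apply/ker_val_inj.
- move=> A B C g f; apply: additive_ext => h; have [z ->] := hclass_surj h.
  by rewrite /= !homologyMapE; congr hclass; apply/ker_val_inj.
Defined.

Record quiver := Quiver {
  vertex :> Type;
  arrow : vertex -> vertex -> Type }.

Record rep (C : category) (Q : quiver) := Rep {
  rob :> Q -> C;
  rmap : forall i j : Q, arrow i j -> hom (rob i) (rob j) }.
Arguments rmap {C Q} G {i j} a : rename.

Record repHom (C : category) (Q : quiver) (G H : rep C Q) := RepHom {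
  rhom :> forall i : Q, hom (G i) (H i);
  rhom_comm : forall (i j : Q) (a : arrow i j),
    compm (rhom j) (rmap G a) = compm (rmap H a) (rhom i) }.

Lemma repHom_ext (C : category) (Q : quiver) (G H : rep C Q)
  (f g : repHom G H) : (forall i, f i = g i) -> f = g.
Proof.
case: f g => [f f0] [g g0] /= fg.
have efg : f = g by apply: functional_extensionality_dep.
by subst g; rewrite (Prop_irrelevance f0 g0).
Qed.

Section RepCat.
Variables (C : category) (Q : quiver).

Definition repHom_id (G : rep C Q) : repHom G G.
Proof.
by refine (@RepHom C Q G G (fun i => idm (G i)) _) => i j a;
  rewrite comp1m compm1.
Defined.

Definition repHom_comp (G H K : rep C Q) (g : repHom H K) (f : repHom G H) :
  repHom G K.
Proof.
by refine (@RepHom C Q G K (fun i => compm (g i) (f i)) _) => i j a;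
  rewrite -compmA rhom_comm compmA rhom_comm compmA.
Defined.

Definition RepCat : category.
Proof.
refine (@Category (rep C Q) (@repHom C Q) repHom_id repHom_comp _ _ _).
- by move=> G H f; apply: repHom_ext => i; exact: compm1.
- by move=> G H f; apply: repHom_ext => i; exact: comp1m.
- by move=> A B G H h g f; apply: repHom_ext => i; exact: compmA.
Defined.
End RepCat.

(* A functor applied at each vertex, each arrow and each component. *)
Section RepFunctor.
Variables (C D : category) (F : functor C D) (Q : quiver).

Definition repF_ob (G : rep C Q) : rep D Q :=
  @Rep D Q (fun i => F (G i)) (fun i j a => fmap F (rmap G a)).

Definition repF_map (G H : rep C Q) (f : repHom G H) :
  repHom (repF_ob G) (repF_ob H).
Proof.
by refine (@RepHom D Q (repF_ob G) (repF_ob H) (fun i => fmap F (f i)) _)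
  => i j a /=; rewrite -!fmapM rhom_comm.
Defined.

Definition repF : functor (RepCat C Q) (RepCat D Q).
Proof.
refine (@Functor (RepCat C Q) (RepCat D Q) repF_ob repF_map _ _).
- by move=> G; apply: repHom_ext => i; exact: fmap1.
- by move=> A B G g f; apply: repHom_ext => i; exact: fmapM.
Defined.
End RepFunctor.

Definition limp (Q : quiver) (G : rep Ab Q) : pred (dprod (rob G)) :=
  fun x => `[< forall (i j : Q) (a : arrow i j), rmap G a (x i) = x j >].

Section Lim.
Variables (Q : quiver) (G : rep Ab Q).

Fact limp_closed : zmod_closed (@limp Q G).
Proof.
split=> [|x y].
  by apply/asboolP => i j a; rewrite dprod0 raddf0.
move=> /asboolP xP /asboolP yP; apply/asboolP => i j a.
by rewrite !dprodB raddfB xP yP.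
Qed.
HB.instance Definition _ :=
  GRing.isZmodClosed.Build (dprod (rob G)) (@limp Q G) limp_closed.

Record lim := Lim { lim_val : dprod (rob G); lim_valP : lim_val \in @limp Q G }.
HB.instance Definition _ := [isSub for lim_val].
HB.instance Definition _ := [Choice of lim by <:].
HB.instance Definition _ := [SubChoice_isSubZmodule of lim by <:].

Lemma limP (x : lim) (i j : Q) (a : arrow i j) : rmap G a (val x i) = val x j.
Proof. by have /asboolP := valP x; apply. Qed.

Lemma lim_ext (x y : lim) : (forall i, val x i = val y i) -> x = y.
Proof.
by move=> xy; apply/val_inj; apply: functional_extensionality_dep.
Qed.
End Lim.

Section LimMap.
Variables (Q : quiver) (G H : rep Ab Q) (f : repHom G H).

Fact limMap_subproof (x : lim G) :
  (fun i => f i (val x i)) \in @limp Q H.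
Proof.
apply/asboolP => i j a; rewrite -(limP x a).
by have /(congr1 (fun h : {additive _ -> _} => h (val x i))) :=
  rhom_comm f a.
Qed.

Definition limMap (x : lim G) : lim H :=
  Lim (limMap_subproof x).

Fact limMap_additive : zmod_morphism limMap.
Proof. by move=> x y; apply: lim_ext => i; exact: raddfB. Qed.
HB.instance Definition _ := GRing.isZmodMorphism.Build _ _
  limMap limMap_additive.
End LimMap.

Definition limF (Q : quiver) : functor (RepCat Ab Q) Ab.
Proof.
refine (@Functor (RepCat Ab Q) Ab (fun G : rep Ab Q => lim G : zmodType)
  (fun G H f => @limMap Q G H f : {additive _ -> _}) _ _).
- by move=> G; apply: additive_ext => x; apply: lim_ext.
- by move=> A B G g f; apply: additive_ext => x; apply: lim_ext.
Defined.

Section LimComplex.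
Variable Q : quiver.

Definition repD (C : rep Ch Q) (i j : int) :
  repHom (repF (degF i) Q C) (repF (degF j) Q C).
Proof.
refine (@RepHom Ab Q (repF (degF i) Q C) (repF (degF j) Q C)
  (fun v => cd (C v) i j) _) => v w a.
by apply: additive_ext => x; rewrite /= cmap_d.
Defined.

Definition limCx (C : rep Ch Q) : chainComplex.
Proof.
refine (@ChainComplex (fun n => limF Q (repF (degF n) Q C))
  (fun i j => fmap (limF Q) (repD C i j)) _ _).
- by move=> i j ij x; apply: lim_ext => v; exact: cd_shape.
- by move=> i j k x; apply: lim_ext => v; exact: cdd.
Defined.

Definition limCxMap (C D : rep Ch Q) (f : repHom C D) :
  chainMap (limCx C) (limCx D).
Proof.
refine (@ChainMap (limCx C) (limCx D)
  (fun n => fmap (limF Q) (fmap (repF (degF n) Q) f)) _) => i j x.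
by apply: lim_ext => v; exact: cmap_d.
Defined.

Definition limCxF : functor (RepCat Ch Q) Ch.
Proof.
refine (@Functor (RepCat Ch Q) Ch limCx limCxMap _ _).
- by move=> C; apply: chainMap_ext => n x; apply: lim_ext.
- by move=> A B C g f; apply: chainMap_ext => n x; apply: lim_ext.
Defined.
End LimComplex.

(* Main.v *)
Require Import Defs.
From HB Require Import structures.
From mathcomp Require Import all_boot all_algebra.
From mathcomp Require Import boolp.

(** The limit complex comes with a projection onto each vertex complex, and
    these projections form a cone: composing the projection to [i] with the map
    of an arrow [i -> j] gives the projection to [j] ([rmap_limCxProj]).  Being a
    functor, homology turns this into a cone of abelian groups over the
    representation of vertexwise homologies, and a cone over a representation
    is the same thing as a map into its limit ([coneMap]).  That map is
    [limHomology]; on the class of a cycle [x] it is the family of the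
    classes of the components [x i].

    Naturality is also inherited from the level of complexes: a map into a
    limit is determined by its components, and the projections commute with
    the maps induced by a morphism of representations ([limCxProj_natural]). *)

Set Implicit Arguments.
Unset Strict Implicit.
Unset Printing Implicit Defensive.

Import GRing.Theory.
Local Open Scope ring_scope.

Section Cone.
Variables (Q : quiver) (G : rep Ab Q) (A : zmodType).
Variable p : forall i : Q, {additive A -> (G i : zmodType)}.
Hypothesis p_cone : forall (i j : Q) (a : arrow i j) (x : A),
  rmap G a (p i x) = p j x.

Fact coneMap_subproof (x : A) : (fun i => p i x) \in @limp Q G.
Proof. by apply/asboolP => i j a; exact: p_cone. Qed.

Definition coneMap (x : A) : lim G := Lim (coneMap_subproof x).

Fact coneMap_additive : zmod_morphism coneMap.
Proof. by move=> x y; apply: lim_ext => i; exact: raddfB. Qed.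
HB.instance Definition _ := GRing.isZmodMorphism.Build _ _
  coneMap coneMap_additive.
End Cone.

Section LimProjection.
Variables (Q : quiver) (G : rep Ab Q) (i : Q).

Definition limProj (x : lim G) : (G i : zmodType) := lim_val x i.

Fact limProj_additive : zmod_morphism limProj.
Proof. by []. Qed.
HB.instance Definition _ := GRing.isZmodMorphism.Build _ _
  limProj limProj_additive.
End LimProjection.

(** The differential of the limit complex acts componentwise, so compatibility
    with the differentials holds by computation. *)
Definition limCxProj (Q : quiver) (C : rep Ch Q) (i : Q) :
    chainMap (limCx C) (C i) :=
  @ChainMap (limCx C) (C i)
    (fun n => @limProj Q (repF (degF n) Q C) i : {additive _ -> _})
    (fun j k x => erefl).

(** This is the equation that defines the elements of a limit, read in each
    degree. *)
Lemma rmap_limCxProj (Q : quiver) (C : rep Ch Q) (i j : Q) (a : arrow i j) :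
  chainMap_comp (rmap C a) (limCxProj C i) = limCxProj C j.
Proof. by apply: chainMap_ext => n x; exact: (limP x a). Qed.

Lemma limCxProj_natural (Q : quiver) (C D : rep Ch Q) (f : repHom C D)
    (i : Q) :
  chainMap_comp (limCxProj D i) (limCxMap f) =
  chainMap_comp (f i) (limCxProj C i).
Proof. by apply: chainMap_ext. Qed.

(** Functoriality of homology in elementwise form, which allows rewriting with
    equations between chain maps. *)
Lemma homologyMap_comp (A B C : chainComplex) (g : chainMap B C)
    (f : chainMap A B) (n : int) (h : homology A n) :
  homologyMap (chainMap_comp g f) h = homologyMap g (homologyMap f h).
Proof.
exact: (congr1 (fun k : {additive _ -> _} => k h)
                (@fmapM _ _ (homologyF n) A B C g f)).
Qed.

Section LimHomology.
Variables (Q : quiver) (n : int).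

(** Any functor carries a cone to a cone; here the functor is homology. *)
Lemma homology_limCxProj_cone (C : rep Ch Q) (i j : Q) (a : arrow i j)
    (h : homology (limCx C) n) :
  rmap (repF (homologyF n) Q C) a (homologyMap (limCxProj C i) h) =
  homologyMap (limCxProj C j) h.
Proof. by rewrite -(rmap_limCxProj C a) homologyMap_comp. Qed.

Definition limHomology (C : rep Ch Q) :
    {additive homology (limCx C) n -> lim (repF (homologyF n) Q C)} :=
  @coneMap Q (repF (homologyF n) Q C) (homology (limCx C) n)
    (fun i => @homologyMap _ _ (limCxProj C i) n : {additive _ -> _})
    (@homology_limCxProj_cone C).

(** Both sides have component [i] equal to the homology of a composite chain map
    from the limit complex of [C] to [D i], so the naturality of the projections
    suffices. *)
Lemma limHomology_natural (C D : rep Ch Q) (f : repHom C D)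
    (h : homology (limCx C) n) :
  limHomology D (homologyMap (limCxMap f) h) =
  limMap (fmap (repF (homologyF n) Q) f) (limHomology C h).
Proof.
apply: lim_ext => i /=.
by rewrite -homologyMap_comp limCxProj_natural homologyMap_comp.
Qed.

Definition limHomologyNT :
  natTrans (fcomp (homologyF n) (limCxF Q))
           (fcomp (limF Q) (repF (homologyF n) Q)).
Proof.
refine (@NatTrans _ _ (fcomp (homologyF n) (limCxF Q))
  (fcomp (limF Q) (repF (homologyF n) Q)) limHomology _) => C D f.
by apply: additive_ext => h; exact: limHomology_natural.
Defined.

End LimHomology.

Theorem theorem4p17 (Q : quiver) (n : nat) :
  exists rho : natTrans (fcomp (homologyF n%:Z) (limCxF Q))
                        (fcomp (limF Q) (repF (homologyF n%:Z) Q)),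
    forall (C : rep Ch Q) (x : cycles (limCx C) n%:Z) (i : Q)
           (z : cycles (C i) n%:Z),
      ker_val z = lim_val (ker_val x) i ->
      lim_val (rho C (hclass x)) i = hclass z.
Proof.
exists (limHomologyNT Q n%:Z) => C x i z zx.
rewrite /= homologyMapE; congr hclass.
(* [z] and the image of [x] under the projection are cycles with the same
   underlying chain, hence the same cycle. *)
by apply/ker_val_inj; rewrite zx.
Qed.
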